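(* Let $R$ be a proper semiring that has either an infinite element or a projective minimal left (or right) ideal. The following statements are equivalent: (i) $R$ is ideal-simple; (ii) $R$ is strongly semiisomorphic to the endomorphism semiring $\mathbf{E}_M$ of a nonzero finite distributive lattice $M$.
   Context: A semiring $(R,+,\cdot,0,1)$ consists of a commutative monoid $(R,+,0)$ and a monoid $(R,\cdot,1)$ such that multiplication distributes over addition on both sides and $0r=0=r0$ for all $r\in R$; it is proper if it is not a ring. An ideal (left, right ideal) is an additive submonoid closed under two-sided (left, right) multiplication by elements of $R$. $R$ is ideal-simple if $0$ and $R$ are its only ideals. An infinite element is an element $\infty\in R$ with $r+\infty=\infty$ for all $r\in R$. A left $R$-semimodule is a commutative monoid $M$ with a unital, associative scalar multiplication $R\times M\to M$ that is additive in each variable and satisfies $r0_M=0_M=0m$ (right semimodules dually). A semimodule is projective if it is a retract of a free semimodule (a direct sum of copies of the regular semimodule). A minimal left (right) ideal is a nonzero left (right) ideal containing no nonzero left (right) ideal properly; it is projective if it is projective as a left (right) $R$-semimodule. A surjective semiring homomorphism $f:R\to S$ is a semiisomorphism if $\mathrm{Ker}(f)=\{x: f(x)=0\}=\{0\}$, and a strong semiisomorphism if moreover for every proper ideal $I$ of $R$ the ideal $f(I)$ of $S$ is proper; $R$ is strongly semiisomorphic to $S$ if there is a strong semiisomorphism $R\to S$. For a lattice $M$ with least element $0$, $\mathbf{E}_M$ is the semiring of all endomorphisms of the monoid $(M,\vee,0)$ with pointwise addition (join) and composition. *)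

(* Defs.v *)
From HB Require Import structures.
From mathcomp Require Import all_boot all_order all_algebra.
From mathcomp Require Import boolp classical_sets functions cardinality.

Set Implicit Arguments.
Unset Strict Implicit.
Unset Printing Implicit Defensive.

Import Order.TTheory GRing.Theory.
Local Open Scope classical_set_scope.
Local Open Scope ring_scope.

(* A semiring is a pzSemiRingType: 0 is absorbing and 1 = 0 is not excluded.  *)

Section Ideals.
Variable R : pzSemiRingType.
Implicit Types I J : set R.

Definition proper_semiring := ~ (forall x : R, exists y, x + y = 0).

Definition infinite_element (w : R) := forall r : R, r + w = w.

Definition additive_submonoid I := I 0 /\ (forall x y, I x -> I y -> I (x + y)).

Definition left_ideal I :=
  additive_submonoid I /\ (forall r x, I x -> I (r * x)).

Definition right_ideal I :=
  additive_submonoid I /\ (forall r x, I x -> I (x * r)).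

Definition ideal I := left_ideal I /\ right_ideal I.

Definition ideal_simple := forall I, ideal I -> I = [set 0] \/ I = setT.

Definition minimal_left_ideal I :=
  [/\ left_ideal I, I <> [set 0] &
    forall J, left_ideal J -> J <> [set 0] -> J `<=` I -> J = I].

Definition minimal_right_ideal I :=
  [/\ right_ideal I, I <> [set 0] &
    forall J, right_ideal J -> J <> [set 0] -> J `<=` I -> J = I].

End Ideals.

Section FreeSemimodule.
Variables (R : pzSemiRingType) (I : Type).

(* The direct sum of I copies of the regular left semimodule.                 *)
Record free_semimod := FreeSemimod {
  coef :> I -> R;
  coef_finite : finite_set [set i | coef i <> 0]
}.

HB.instance Definition _ := gen_eqMixin free_semimod.
HB.instance Definition _ := gen_choiceMixin free_semimod.

Lemma free_semimodP (f g : free_semimod) : (forall i, f i = g i) -> f = g.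
Proof.
case: f g => [f hf] [g hg] /= fg.
have {}fg : f = g by apply/funext.
by subst g; rewrite (Prop_irrelevance hf hg).
Qed.

Fact free_zero_finite : finite_set [set i : I | (0 : R) <> 0].
Proof.
rewrite (_ : [set i | _] = set0); first exact: finite_set0.
by rewrite eqEsubset; split=> i //= /(_ erefl).
Qed.

Fact free_add_finite (f g : free_semimod) :
  finite_set [set i | f i + g i <> 0].
Proof.
apply: (@sub_finite_set _ _ ([set i | f i <> 0] `|` [set i | g i <> 0])).
  move=> i /= fgi; have [fi0|] := pselect (f i = 0); last by left.
  by right=> gi0; apply: fgi; rewrite fi0 gi0 addr0.
by rewrite finite_setU; split; exact: coef_finite.
Qed.

Fact free_scale_finite (a : R) (f : free_semimod) :
  finite_set [set i | a * f i <> 0].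
Proof.
apply: sub_finite_set (coef_finite f) => i /= afi fi0.
by apply: afi; rewrite fi0 mulr0.
Qed.

Definition free_zero := FreeSemimod free_zero_finite.
Definition free_add f g := FreeSemimod (free_add_finite f g).
Definition free_scale a f := FreeSemimod (free_scale_finite a f).

Fact free_addA : associative free_add.
Proof. by move=> f g h; apply: free_semimodP => i /=; rewrite addrA. Qed.
Fact free_addC : commutative free_add.
Proof. by move=> f g; apply: free_semimodP => i /=; rewrite addrC. Qed.
Fact free_add0 : left_id free_zero free_add.
Proof. by move=> f; apply: free_semimodP => i /=; rewrite add0r. Qed.

HB.instance Definition _ :=
  GRing.isNmodule.Build free_semimod free_addA free_addC free_add0.

Fact free_scaleA a b f : free_scale a (free_scale b f) = free_scale (a * b) f.
Proof. by apply: free_semimodP => i /=; rewrite mulrA. Qed.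
Fact free_scale0 f : free_scale 0 f = 0.
Proof. by apply: free_semimodP => i /=; rewrite mul0r. Qed.
Fact free_scale1 : left_id 1 free_scale.
Proof. by move=> f; apply: free_semimodP => i /=; rewrite mul1r. Qed.
Fact free_scaleDr : right_distributive free_scale +%R.
Proof. by move=> a f g; apply: free_semimodP => i /=; rewrite mulrDr. Qed.
Fact free_scaleDl f : {morph free_scale^~ f : a b / a + b}.
Proof. by move=> a b; apply: free_semimodP => i /=; rewrite mulrDl. Qed.

HB.instance Definition _ := GRing.Nmodule_isLSemiModule.Build R free_semimod
  free_scaleA free_scale0 free_scale1 free_scaleDr free_scaleDl.

End FreeSemimodule.

Definition projective (R : pzSemiRingType) (P : lSemiModType R) :=
  exists (I : Type) (i : {linear P -> free_semimod R I})
         (p : {linear free_semimod R I -> P}),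
    forall x, p (i x) = x.

Section LeftIdealSemimodule.
Variables (R : pzSemiRingType) (L : set R) (hL : left_ideal L).

(* The closure proof is a parameter of the type so that instance inference
   can find it.                                                               *)
Record left_ideal_semimod (h : left_ideal L) := LeftIdealSemimod {
  lideal_val :> R^o;
  lideal_valP : lideal_val \in (L : set R^o)
}.

HB.instance Definition _ := [isSub of left_ideal_semimod hL for @lideal_val hL].
HB.instance Definition _ := [Choice of left_ideal_semimod hL by <:].

Fact left_ideal_subsemimod :
  subsemimod_closed (fun x : R^o => x \in (L : set R^o)).
Proof.
case: hL => -[L0 LD] LM; split; first split.
- by rewrite unfold_in; exact/mem_set.
- move=> x y; rewrite !unfold_in => /set_mem Lx /set_mem Ly.
  exact/mem_set/LD.
- by move=> a x; rewrite !unfold_in => /set_mem Lx; exact/mem_set/LM.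
Qed.

HB.instance Definition _ := GRing.SubChoice_isSubLSemiModule.Build R R^o
  (fun x : R^o => x \in (L : set R^o)) (left_ideal_semimod hL)
  left_ideal_subsemimod.

End LeftIdealSemimodule.

(* Right R-semimodules are left semimodules over the converse semiring R^c,   *)
(* and right ideals of R are, by conversion, left ideals of R^c.              *)
Definition right_ideal_semimod (R : pzSemiRingType) (L : set R)
    (hL : right_ideal L) : lSemiModType R^c :=
  left_ideal_semimod (hL : @left_ideal R^c L).

Definition has_infinite_element (R : pzSemiRingType) :=
  exists w : R, infinite_element w.

Definition has_projective_minimal_left_ideal (R : pzSemiRingType) :=
  exists (L : set R) (hL : left_ideal L),
    minimal_left_ideal L /\ projective (left_ideal_semimod hL).

Definition has_projective_minimal_right_ideal (R : pzSemiRingType) :=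
  exists (L : set R) (hL : right_ideal L),
    minimal_right_ideal L /\ projective (right_ideal_semimod hL).

Section Semiisomorphisms.
Variables R S : pzSemiRingType.

Definition semiisomorphism (f : {rmorphism R -> S}) :=
  (forall y, exists x, f x = y) /\ [set x | f x = 0] = [set 0].

Definition strong_semiisomorphism (f : {rmorphism R -> S}) :=
  semiisomorphism f /\
  (forall I : set R, ideal I -> I <> setT -> f @` I <> setT).

Definition strongly_semiisomorphic :=
  exists f : {rmorphism R -> S}, strong_semiisomorphism f.

End Semiisomorphisms.

Section EndomorphismSemiring.
Context {d : Order.disp_t}.
Variable M : bLatticeType d.

Local Notation "x \v y" := (Order.join x y) (at level 50, left associativity).
Local Notation bot := (Order.bottom : M).

(* The carrier of E_M: endomorphisms of the monoid (M, join, bottom).         *)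
Record join_endo := JoinEndo {
  endo_fun :> M -> M;
  endo_bot : endo_fun bot = bot;
  endo_join : forall x y, endo_fun (x \v y) = endo_fun x \v endo_fun y
}.

HB.instance Definition _ := gen_eqMixin join_endo.
HB.instance Definition _ := gen_choiceMixin join_endo.

Lemma join_endoP (f g : join_endo) : (forall x, f x = g x) -> f = g.
Proof.
case: f g => [f hf kf] [g hg kg] /= fg.
have {}fg : f = g by apply/funext.
by subst g; rewrite (Prop_irrelevance hf hg) (Prop_irrelevance kf kg).
Qed.

Fact endo_add_join (f g : join_endo) x y :
  f (x \v y) \v g (x \v y) = (f x \v g x) \v (f y \v g y).
Proof. by rewrite !endo_join joinACA. Qed.
Fact endo_add_bot (f g : join_endo) : f bot \v g bot = bot.
Proof. by rewrite !endo_bot joinxx. Qed.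
Fact endo_mul_join (f g : join_endo) x y : f (g (x \v y)) = f (g x) \v f (g y).
Proof. by rewrite !endo_join. Qed.
Fact endo_mul_bot (f g : join_endo) : f (g bot) = bot.
Proof. by rewrite !endo_bot. Qed.

Definition endo_zero :=
  @JoinEndo (fun=> bot) erefl (fun _ _ => esym (joinxx bot)).
Definition endo_one := @JoinEndo id erefl (fun _ _ => erefl).
Definition endo_add (f g : join_endo) :=
  @JoinEndo (fun x => f x \v g x) (endo_add_bot f g) (endo_add_join f g).
Definition endo_mul (f g : join_endo) :=
  @JoinEndo (fun x => f (g x)) (endo_mul_bot f g) (endo_mul_join f g).

Fact endo_addA : associative endo_add.
Proof. by move=> f g h; apply: join_endoP => x /=; rewrite joinA. Qed.
Fact endo_addC : commutative endo_add.
Proof. by move=> f g; apply: join_endoP => x /=; rewrite joinC. Qed.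
Fact endo_add0 : left_id endo_zero endo_add.
Proof. by move=> f; apply: join_endoP => x /=; rewrite join0x. Qed.
Fact endo_mulA : associative endo_mul.
Proof. by move=> f g h; apply: join_endoP. Qed.
Fact endo_mul1f : left_id endo_one endo_mul.
Proof. by move=> f; apply: join_endoP. Qed.
Fact endo_mulf1 : right_id endo_one endo_mul.
Proof. by move=> f; apply: join_endoP. Qed.
Fact endo_mulDl : left_distributive endo_mul endo_add.
Proof. by move=> f g h; apply: join_endoP. Qed.
Fact endo_mulDr : right_distributive endo_mul endo_add.
Proof. by move=> f g h; apply: join_endoP => x /=; rewrite endo_join. Qed.
Fact endo_mul0f : left_zero endo_zero endo_mul.
Proof. by move=> f; apply: join_endoP. Qed.
Fact endo_mulf0 : right_zero endo_zero endo_mul.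
Proof. by move=> f; apply: join_endoP => x /=; rewrite endo_bot. Qed.

HB.instance Definition _ := GRing.isPzSemiRing.Build join_endo
  endo_addA endo_addC endo_add0 endo_mulA endo_mul1f endo_mulf1
  endo_mulDl endo_mulDr endo_mul0f endo_mulf0.

End EndomorphismSemiring.

(* Main.v *)
(* If R is ideal-simple and L is a minimal left ideal, then L R = R, so
   1 = sum_k u_k v_k with all u_k in L, and minimality makes a u_j v_k b vanish
   exactly when a u_j = 0 or L v_k b = 0. (When w is an infinite element, R w is
   such an L; minimal right ideals are treated in the converse semiring.) Since
   R is zerosumfree, sending b to the set of those k with L v_k b <> 0 turns
   left multiplications into Boolean matrices of size n. The sets so obtained
   are the fixed points of the idempotent matrix of 1; they form a finite
   distributive lattice M, and R acts on M with trivial kernel and through all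
   of E_M. Conversely, E_M is ideal-simple for every finite distributive M: a
   nonzero ideal contains all rank-one maps, and the identity is the join of the
   maps x |-> (p if p <= x, else 0) over the join-primes p. *)
Require Import Defs.
From HB Require Import structures.
From mathcomp Require Import all_boot all_order all_algebra.
From mathcomp Require Import boolp classical_sets functions cardinality.

Set Implicit Arguments.
Unset Strict Implicit.
Unset Printing Implicit Defensive.

Import Order.TTheory GRing.Theory.
Local Open Scope ring_scope.

(** * The lattice of fixed sets of an idempotent Boolean matrix *)

Section FixedSets.
Variable T : finType.
Implicit Types (c : rel T) (A B : {set T}).

Definition rel_image c A : {set T} := [set k | [exists l in A, c k l]]%SET.

Lemma rel_image0 c : rel_image c finset.set0 = finset.set0.
Proof. by apply/setP=> k; rewrite !inE; apply/exists_inP=> -[l]; rewrite inE. Qed.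

Lemma rel_imageU c A B :
  rel_image c (A :|: B) = rel_image c A :|: rel_image c B.
Proof.
apply/setP=> k; rewrite !inE; apply/exists_inP/orP.
  by case=> l; rewrite inE => /orP[] lA ck; [left|right]; apply/exists_inP; exists l.
by case=> /exists_inP[l lA ck]; exists l; rewrite // inE lA ?orbT.
Qed.

Lemma rel_imageS c A B : A \subset B -> rel_image c A \subset rel_image c B.
Proof.
move=> /fintype.subsetP sAB; apply/fintype.subsetP=> k; rewrite !inE => /exists_inP[l lA ck].
by apply/exists_inP; exists l => //; exact: sAB.
Qed.

Definition rel_idempotent c := forall A, rel_image c (rel_image c A) = rel_image c A.

Variables (c : rel T) (hc : rel_idempotent c).

(* As with left_ideal_semimod, the proof is a parameter of the type so that
   instance inference can find it. *)
Record fixset (h : rel_idempotent c) := Fixset {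
  fixset_val :> {set T};
  fixsetP : rel_image c fixset_val == fixset_val
}.

HB.instance Definition _ := [isSub of fixset hc for @fixset_val hc].
HB.instance Definition _ := [Finite of fixset hc by <:].

Implicit Types X Y Z : fixset hc.

Lemma fixset_eqP X Y : fixset_val X = fixset_val Y -> X = Y.
Proof. exact: val_inj. Qed.

Fact fixset_join_subproof X Y : rel_image c (X :|: Y) == X :|: Y.
Proof. by rewrite rel_imageU (eqP (fixsetP X)) (eqP (fixsetP Y)). Qed.

Definition fixset_join X Y : fixset hc := Fixset hc (fixset_join_subproof X Y).

(** An intersection of fixed sets need not be fixed; its image under [c] is the largest fixed set
    inside it. *)
Definition fixset_meet X Y : fixset hc :=
  Fixset hc (introT eqP (hc (X :&: Y))).

Lemma sub_fixset_meet X Y Z :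
  (Z \subset fixset_meet X Y) = (Z \subset X) && (Z \subset Y).
Proof.
rewrite -finset.subsetI /=; apply/idP/idP => [sZ|/(rel_imageS c)]; last first.
  by rewrite (eqP (fixsetP Z)).
apply: fintype.subset_trans sZ _; rewrite finset.subsetI.
by rewrite -{2}(eqP (fixsetP X)) -{3}(eqP (fixsetP Y)) !rel_imageS ?finset.subsetIl ?finset.subsetIr.
Qed.

(** Reduces the laws of [fixset_meet] to Boolean identities through [sub_fixset_meet]. *)
Lemma fixset_eq_sub X Y : (forall Z, (Z \subset X) = (Z \subset Y)) -> X = Y.
Proof.
by move=> eqXY; apply: fixset_eqP; apply/eqP; rewrite finset.eqEsubset eqXY subxx -eqXY subxx.
Qed.

Fact fixset_display : Order.disp_t. Proof. exact: Order.Disp tt tt. Qed.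

Fact fixset_le_def X Y : (X \subset Y) = (fixset_meet X Y == X).
Proof.
apply/idP/eqP => [sXY|<-].
  apply: fixset_eq_sub => Z; rewrite sub_fixset_meet andb_idr //.
  by move=> sZX; exact: fintype.subset_trans sZX sXY.
by have := subxx (fixset_meet X Y); rewrite sub_fixset_meet => /andP[].
Qed.
Fact fixset_meetC : commutative fixset_meet.
Proof. by move=> X Y; apply: fixset_eq_sub => Z; rewrite !sub_fixset_meet andbC. Qed.
Fact fixset_joinC : commutative fixset_join.
Proof. by move=> X Y; apply: fixset_eqP; rewrite /= finset.setUC. Qed.
Fact fixset_meetA : associative fixset_meet.
Proof. by move=> X Y Z; apply: fixset_eq_sub => W; rewrite !sub_fixset_meet andbA. Qed.
Fact fixset_joinA : associative fixset_join.
Proof. by move=> X Y Z; apply: fixset_eqP; rewrite /= finset.setUA. Qed.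
Fact fixset_joinKI Y X : fixset_meet X (fixset_join X Y) = X.
Proof. by apply/eqP; rewrite -fixset_le_def finset.subsetUl. Qed.
Fact fixset_meetKU Y X : fixset_join X (fixset_meet X Y) = X.
Proof.
apply: fixset_eqP; apply/finset.setUidPl.
by have := subxx (fixset_meet X Y); rewrite sub_fixset_meet => /andP[].
Qed.
(** Intersection distributes over union, and [rel_image c] preserves unions. *)
Fact fixset_meetUl : left_distributive fixset_meet fixset_join.
Proof. by move=> X Y Z; apply: fixset_eqP; rewrite /= finset.setIUl rel_imageU. Qed.
Fact fixset_meetxx : idempotent_op fixset_meet.
Proof. by move=> X; apply/eqP; rewrite -fixset_le_def. Qed.

HB.instance Definition _ := Order.isMeetJoinDistrLattice.Build fixset_display
  (fixset hc) fixset_le_def (fun _ _ => erefl) fixset_meetC fixset_joinC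
  fixset_meetA fixset_joinA fixset_joinKI fixset_meetKU fixset_meetUl
  fixset_meetxx.

Definition fixset_bot : fixset hc := Fixset hc (introT eqP (rel_image0 c)).
Definition fixset_top : fixset hc := Fixset hc (introT eqP (hc [set: T])).

Fact fixset_bot_le X : (fixset_bot <= X)%O. Proof. exact: finset.sub0set. Qed.
Fact fixset_le_top X : (X <= fixset_top)%O.
Proof.
change (X \subset rel_image c [set: T]); rewrite -{1}(eqP (fixsetP X)).
by rewrite rel_imageS ?finset.subsetT.
Qed.

HB.instance Definition _ :=
  Order.hasBottom.Build fixset_display (fixset hc) fixset_bot_le.
HB.instance Definition _ :=
  Order.hasTop.Build fixset_display (fixset hc) fixset_le_top.

End FixedSets.

(** * Representation on a finite distributive lattice *)

(* [al j a] reads "a kills u_j" and [be k b] reads "v_k kills b", up to a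
   one-sided ideal that may stand in between. *)
Definition separated_unit (R : pzSemiRingType) :=
  exists n (u v : 'I_n -> R) (al be : 'I_n -> pred R),
    1 = \sum_k u k * v k /\
    forall a b j k, (a * u j * (v k * b) == 0) = al j a || be k b.

Section Representation.
Variables (R : pzSemiRingType) (n : nat).
Variables (u v : 'I_n -> R) (al be : 'I_n -> pred R).
Hypothesis R_nontrivial : (1 : R) <> 0.
Hypothesis R_zerosumfree : forall x y : R, x + y = 0 -> x = 0.
Hypothesis unit_sum : 1 = \sum_k u k * v k.
Hypothesis separated :
  forall a b j k, (a * u j * (v k * b) == 0) = al j a || be k b.

Lemma addr_eq0_zsf (x y : R) : (x + y == 0) = (x == 0) && (y == 0).
Proof.
apply/eqP/andP => [xy0|[/eqP-> /eqP->]]; last by rewrite addr0.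
by split; apply/eqP; [exact: (R_zerosumfree xy0)|apply: (@R_zerosumfree _ x); rewrite addrC].
Qed.

Lemma sumr_eq0_zsf (P : pred 'I_n) (F : 'I_n -> R) :
  (\sum_(k | P k) F k == 0) = [forall k, P k ==> (F k == 0)].
Proof.
rewrite -big_andE; elim/big_ind2: _ => [|x b y b' <- <-|//]; first by rewrite eqxx.
by rewrite addr_eq0_zsf.
Qed.

(** Insert [1 = \sum_k u k * v k] between the factors; by zerosumfreeness the sum vanishes only
    termwise. *)
Lemma mulr_eq0_separated a b : (a * b == 0) = [forall k, al k a || be k b].
Proof.
rewrite -{1}[a]mulr1 unit_sum mulr_sumr mulr_suml sumr_eq0_zsf.
by apply: eq_forallb => k; rewrite -separated !mulrA.
Qed.

(** Otherwise [1 * 1 = 0]. A fixed pivot removes the [al] alternative from [separated], so that [be]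
    becomes the vanishing of a single product in [be_eq0]. *)
Lemma left_pivot : {j | ~~ al j 1}.
Proof.
apply/sigW; apply/existsP; rewrite -negb_forall; apply/negP => /forallP al1.
apply: R_nontrivial; apply/eqP; rewrite -[1]mulr1 mulr_eq0_separated.
by apply/forallP => k; rewrite al1.
Qed.

Lemma right_pivot : {k | ~~ be k 1}.
Proof.
apply/sigW; apply/existsP; rewrite -negb_forall; apply/negP => /forallP be1.
apply: R_nontrivial; apply/eqP; rewrite -[1]mulr1 mulr_eq0_separated.
by apply/forallP => k; rewrite be1 orbT.
Qed.

Let j0 := sval left_pivot.
Let k0 := sval right_pivot.

Lemma be_eq0 k b : be k b = (u j0 * (v k * b) == 0).
Proof. by rewrite -[u j0]mul1r separated (negPf (svalP left_pivot)). Qed.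

Definition cosupport b : {set 'I_n} := [set k | ~~ be k b]%SET.

Lemma cosupport0 : cosupport 0 = finset.set0.
Proof. by apply/setP => k; rewrite !inE be_eq0 !mulr0 eqxx. Qed.

Lemma cosupportD a b : cosupport (a + b) = cosupport a :|: cosupport b.
Proof. by apply/setP => k; rewrite !inE !be_eq0 !mulrDr addr_eq0_zsf negb_and. Qed.

Lemma cosupport_sum (P : pred 'I_n) (F : 'I_n -> R) k :
  (k \in cosupport (\sum_(i | P i) F i)) = [exists (i | P i), k \in cosupport (F i)].
Proof.
rewrite inE be_eq0 !mulr_sumr sumr_eq0_zsf negb_forall.
by apply: eq_existsb => i; rewrite negb_imply inE be_eq0.
Qed.

Lemma cosupport_eq0 b : cosupport b = finset.set0 -> b = 0.
Proof.
move=> Kb; apply/eqP; rewrite -[b]mul1r mulr_eq0_separated; apply/forallP => k.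
by have := finset.in_set0 k; rewrite -Kb inE => /negbFE ->; rewrite orbT.
Qed.

(** The Boolean matrix of left multiplication by [s]: by [separated] at [k0], the entry holds iff
    [u j0 * v k * s * u l * v k0] is nonzero. *)
Definition entry s : rel 'I_n := fun k l => ~~ al l (u j0 * v k * s).

Lemma cosupportM s b : cosupport (s * b) = rel_image (entry s) (cosupport b).
Proof.
apply/setP => k; rewrite !inE be_eq0 !mulrA mulr_eq0_separated negb_forall.
by apply: eq_existsb => l; rewrite negb_or inE andbC.
Qed.

Lemma cosupport_column l :
  cosupport (u l * v k0) = [set k | entry 1 k l]%SET.
Proof.
apply/setP => k; rewrite !inE be_eq0 /entry mulr1 !mulrA -[v k0]mulr1.
by rewrite separated (negPf (svalP right_pivot)) orbF.
Qed.

Definition combination (A : {set 'I_n}) := \sum_(l in A) u l * v k0.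

Lemma cosupport_combination A :
  cosupport (combination A) = rel_image (entry 1) A.
Proof.
apply/setP => k; rewrite cosupport_sum inE; apply: eq_existsb => l.
by rewrite cosupport_column inE.
Qed.

(** Every image under [entry 1] is the cosupport of a combination, and on cosupports [entry 1] acts
    as multiplication by 1. *)
Lemma entry1_idempotent : rel_idempotent (entry 1).
Proof. by move=> A; rewrite -(cosupport_combination A) -cosupportM mul1r. Qed.

Definition lat := fixset entry1_idempotent.

Lemma lat_combination (X : lat) : cosupport (combination X) = X.
Proof. by rewrite cosupport_combination (eqP (fixsetP X)). Qed.

Fact cosupport_lat_subproof b : rel_image (entry 1) (cosupport b) == cosupport b.
Proof. by rewrite -cosupportM mul1r. Qed.

Definition cosupport_lat b : lat := Fixset entry1_idempotent (cosupport_lat_subproof b).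

Lemma cosupport_lat_onto (X : lat) : exists b, X = cosupport_lat b.
Proof. by exists (combination X); apply: fixset_eqP; rewrite /= lat_combination. Qed.

Lemma cosupport_lat0 : cosupport_lat 0 = Order.bottom.
Proof. by apply: fixset_eqP; exact: cosupport0. Qed.

Lemma cosupport_latD a b :
  cosupport_lat (a + b) = Order.join (cosupport_lat a) (cosupport_lat b).
Proof. by apply: fixset_eqP; exact: cosupportD. Qed.

(** [combination X] is one element with cosupport [X]; any other gives the same result, since
    [cosupport (s * b)] depends on [b] only through [cosupport b]. *)
Definition act s (X : lat) : lat := cosupport_lat (s * combination X).

Lemma act_cosupport s b : act s (cosupport_lat b) = cosupport_lat (s * b).
Proof. by apply: fixset_eqP; rewrite /= cosupportM (lat_combination (cosupport_lat b)) -cosupportM. Qed.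

Fact act_bot s : act s Order.bottom = Order.bottom.
Proof. by rewrite -cosupport_lat0 act_cosupport mulr0. Qed.

Fact act_join s X Y : act s (Order.join X Y) = Order.join (act s X) (act s Y).
Proof.
have [[a ->] [b ->]] := (cosupport_lat_onto X, cosupport_lat_onto Y).
by rewrite -cosupport_latD !act_cosupport mulrDr cosupport_latD.
Qed.

Definition repr s : join_endo lat := JoinEndo (act_bot s) (act_join s).

Lemma repr_cosupport s b : repr s (cosupport_lat b) = cosupport_lat (s * b).
Proof. exact: act_cosupport. Qed.

Fact repr_nmod_morphism : nmod_morphism repr.
Proof.
split=> [|s t]; apply: join_endoP => X; have [b ->] := cosupport_lat_onto X.
  by rewrite repr_cosupport mul0r cosupport_lat0.
by rewrite repr_cosupport mulrDl cosupport_latD -!repr_cosupport.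
Qed.

Fact repr_monoid_morphism : monoid_morphism repr.
Proof.
split=> [|s t]; apply: join_endoP => X; have [b ->] := cosupport_lat_onto X.
  by rewrite repr_cosupport mul1r.
by rewrite repr_cosupport -mulrA -!repr_cosupport.
Qed.

HB.instance Definition _ :=
  GRing.isNmodMorphism.Build R (join_endo lat) repr repr_nmod_morphism.
HB.instance Definition _ :=
  GRing.isMonoidMorphism.Build R (join_endo lat) repr repr_monoid_morphism.

Lemma repr_eq0 s : repr s = 0 -> s = 0.
Proof.
move=> s0; apply: cosupport_eq0; rewrite -[s]mulr1.
by have := repr_cosupport s 1; rewrite s0 => /(congr1 (@fixset_val _ _ _)) /esym.
Qed.

(* Up to cosupport, the factor [v k * b] only matters through [be k b]. *)
Lemma cosupport_factor l k b :
  cosupport (u l * (v k * b)) =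
    if be k b then finset.set0 else cosupport (u l * v k0).
Proof.
apply/setP => j; rewrite inE be_eq0 2!mulrA separated; case: ifP => _.
  by rewrite finset.in_set0 orbT.
by rewrite orbF cosupport_column inE /entry mulr1.
Qed.

(** The cosupport of [b] is the join of the [col k] over the [k] with [be k b] false, so [g] is
    determined by the sets [g (col k)]. The factor [t k] is chosen to make [t k * v k * b] have
    cosupport [g (col k)] for exactly these [k], and the empty one otherwise. *)
Lemma repr_onto (g : join_endo lat) : exists s, repr s = g.
Proof.
pose col k := cosupport_lat (u k * v k0).
pose t k := \sum_(l in (g (col k) : {set 'I_n})) u l.
exists (\sum_k t k * v k); apply: join_endoP => X.
have [b ->] := cosupport_lat_onto X; rewrite repr_cosupport.
have -> : cosupport_lat b = cosupport_lat ((\sum_k u k * v k) * b).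
  by congr cosupport_lat; rewrite -unit_sum mul1r.
rewrite !mulr_suml; apply: esym.
elim/big_ind2: _ => [|x x' y y' gx gy|k _].
- by rewrite cosupport_lat0 endo_bot.
- by rewrite !cosupport_latD endo_join gx gy.
have Kt : cosupport (t k * v k * b) =
    if be k b then finset.set0 else (g (col k) : {set 'I_n}).
  rewrite -mulrA mulr_suml; apply/setP => j; rewrite cosupport_sum.
  under eq_existsb => l do rewrite cosupport_factor.
  case: (be k b); last first.
    by rewrite -[in RHS](lat_combination (g (col k))) cosupport_sum.
  by rewrite finset.in_set0; apply/exists_inP => -[].
have Ku : cosupport (u k * v k * b) =
    if be k b then finset.set0 else (col k : {set 'I_n}).
  by rewrite -mulrA cosupport_factor.
case: (be k b) Kt Ku => Kt Ku.
  rewrite (_ : cosupport_lat (u k * v k * b) = Order.bottom); last exact: fixset_eqP.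
  by rewrite endo_bot; apply: fixset_eqP; rewrite /= Kt.
rewrite (_ : cosupport_lat (u k * v k * b) = col k); last exact: fixset_eqP.
by apply: fixset_eqP; rewrite /= Kt.
Qed.

Lemma lat_nontrivial : exists X : lat, X <> Order.bottom.
Proof.
exists (cosupport_lat 1) => /(congr1 (@fixset_val _ _ _)) /cosupport_eq0.
exact: R_nontrivial.
Qed.

End Representation.

Lemma join_endo_nontrivial d (M : bLatticeType d) :
  (exists x : M, x <> Order.bottom) -> (1 : join_endo M) <> 0.
Proof. by case=> x x0 /(congr1 (fun f : join_endo M => f x)). Qed.

Lemma strong_semiiso_of_separated_unit (R : pzSemiRingType) :
  (1 : R) <> 0 -> (forall x y : R, x + y = 0 -> x = 0) -> ideal_simple R ->
  separated_unit R ->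
  exists (d : Order.disp_t) (M : finTBDistrLatticeType d),
    (exists x : M, x <> Order.bottom :> M) /\ strongly_semiisomorphic R (join_endo M).
Proof.
move=> R1 Rzsf Rsimple [n [u [v [al [be [uv1 sep]]]]]].
exists fixset_display, (lat R1 Rzsf uv1 sep); split; first exact: lat_nontrivial.
exists (repr R1 Rzsf uv1 sep); split; first split.
- exact: repr_onto.
- rewrite eqEsubset; split=> x /=; first exact: repr_eq0.
  by move=> ->; rewrite raddf0.
(* A proper ideal is zero by simplicity, and the image of zero misses 1. *)
move=> I /Rsimple[->|//] _ im1.
apply: (join_endo_nontrivial (lat_nontrivial R1 Rzsf uv1 sep)).
have : setT (1 : join_endo (lat R1 Rzsf uv1 sep)) by [].
by rewrite -im1 => -[_ -> <-]; rewrite raddf0.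
Qed.

(** * Minimal left ideals of ideal-simple semirings *)

Section IdealSimple.
Variable R : pzSemiRingType.
Implicit Types (L I : set R) (x y z w : R).
Local Open Scope classical_set_scope.

Lemma proper_semiring_nontrivial : proper_semiring R -> (1 : R) <> 0.
Proof.
move=> Rproper R10; apply: Rproper => x; exists x.
by rewrite -[x]mulr1 R10 mulr0 addr0.
Qed.

(** The additively invertible elements form an ideal, which cannot be all of [R] because [R] is not
    a ring. *)
Lemma ideal_simple_zerosumfree x y :
  proper_semiring R -> ideal_simple R -> x + y = 0 -> x = 0.
Proof.
move=> Rproper Rsimple xy0; pose V := [set z : R | exists t, z + t = 0].
have idealV : ideal V.
  have subV : additive_submonoid V.
    split=> [|z t [z' zz'] [t' tt']]; first by exists 0; rewrite addr0.
    by exists (z' + t'); rewrite addrACA zz' tt' addr0.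
  split; split=> // r z [t zt].
    by exists (r * t); rewrite -mulrDr zt mulr0.
  by exists (t * r); rewrite -mulrDl zt mul0r.
have Vx : V x by exists y.
case: (Rsimple V idealV) => [V0|VT]; first by move: Vx; rewrite V0.
by case: Rproper => z; have : V z by rewrite VT.
Qed.

Definition right_span L := [set x : R | exists s : seq (R * R),
  (forall p, p \in s -> L p.1) /\ x = \sum_(p <- s) p.1 * p.2].

Lemma ideal_right_span L : left_ideal L -> ideal (right_span L).
Proof.
move=> [_ LM].
have span_sub : additive_submonoid (right_span L).
  split=> [|_ _ [s [sL ->]] [t [tL ->]]]; first by exists [::]; rewrite big_nil.
  exists (s ++ t); rewrite big_cat; split=> // p.
  by rewrite mem_cat => /orP[/sL|/tL].
split; split=> // r _ [s [sL ->]].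
  exists [seq (r * p.1, p.2) | p <- s]; split.
    by move=> _ /mapP[p /sL Lp ->]; exact: LM.
  by rewrite big_map mulr_sumr; apply: eq_bigr => p _; rewrite mulrA.
exists [seq (p.1, p.2 * r) | p <- s]; split.
  by move=> _ /mapP[p /sL Lp ->].
by rewrite big_map mulr_suml; apply: eq_bigr => p _; rewrite mulrA.
Qed.

Lemma ideal_simple_unit L x : ideal_simple R -> left_ideal L -> L x -> x <> 0 ->
  exists n (u v : 'I_n -> R), (forall k, L (u k)) /\ 1 = \sum_k u k * v k.
Proof.
move=> Rsimple idL Lx x0.
have spanx : right_span L x.
  by exists [:: (x, 1)]; split=> [p|]; rewrite ?big_seq1 ?mulr1 // inE => /eqP ->.
case: (Rsimple _ (ideal_right_span idL)) => [span0|spanT].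
  by move: spanx; rewrite span0.
have [s [sL ->]] : right_span L 1 by rewrite spanT.
exists (size s), (fun k => (tnth (in_tuple s) k).1), (fun k => (tnth (in_tuple s) k).2).
by split=> [k|]; [apply: sL; exact: mem_tnth|rewrite big_tnth].
Qed.

Lemma left_ideal_principal y : left_ideal [set x : R | exists r, x = r * y].
Proof.
split; first split; first by exists 0; rewrite mul0r.
  by move=> _ _ [a ->] [b ->]; exists (a + b); rewrite mulrDl.
by move=> a _ [b ->]; exists (a * b); rewrite mulrA.
Qed.

Lemma left_ideal_nonzero L : left_ideal L -> L <> [set 0] -> exists2 x, L x & x <> 0.
Proof.
move=> [[L0 _] _] Ln0; apply: contrapT => noL; apply: Ln0.
rewrite eqEsubset; split=> x /=; last by move=> ->.
by move=> Lx; apply: contrapT => x0; apply: noL; exists x.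
Qed.

(** The elements of [L] killed by [b] form a left ideal inside [L], nonzero because of [a]. *)
Lemma minimal_left_ideal_kernel L a b :
  minimal_left_ideal L -> L a -> a * b = 0 -> a <> 0 -> forall z, L z -> z * b = 0.
Proof.
move=> [[[L0 LD] LM] _ Lmin] La ab0 a0.
pose N := [set z | L z /\ z * b = 0].
have idN : left_ideal N.
  split; first split; first by split; rewrite ?mul0r.
    by move=> y z [Ly yb] [Lz zb]; split; [exact: LD|rewrite mulrDl yb zb addr0].
  by move=> r z [Lz zb]; split; [exact: LM|rewrite -mulrA zb mulr0].
have Na : N a by [].
have NL : N = L.
  apply: Lmin => //; last by move=> z [].
  by move=> N0; move: Na; rewrite N0.
by move=> z; rewrite -NL => -[].
Qed.

Lemma minimal_left_ideal_separated_unit L :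
  ideal_simple R -> minimal_left_ideal L -> separated_unit R.
Proof.
move=> Rsimple Lmin; have [idL Ln0 _] := Lmin.
have [x Lx x0] := left_ideal_nonzero idL Ln0.
have [n [u [v [Lu uv1]]]] := ideal_simple_unit Rsimple idL Lx x0.
exists n, u, v, (fun k a => a * u k == 0).
(* The test for [be] is annihilation by all of [L], not [v k * b = 0]: this is what minimality
   yields from one nonzero [a * u j] in [L]. *)
exists (fun k b => `[< forall z, L z -> z * (v k * b) = 0 >]); split=> // a b j k.
have Lau : L (a * u j) by case: idL => _; exact.
apply/eqP/orP => [aub|[/eqP->|/asboolP]]; rewrite ?mul0r //; last exact.
have [|au0] := eqVneq (a * u j) 0; first by left.
by right; apply/asboolP; apply: minimal_left_ideal_kernel Lmin Lau aub (elimN eqP au0).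
Qed.

(* With the preorder [x <= y] iff [x + y = y], a representation of [1] in the
   ideal generated by [r * w] gives [1 <= w * r * w], hence [w * r * w = w]. *)
Lemma infinite_element_absorb w r :
  ideal_simple R -> infinite_element w -> r * w <> 0 -> w * r * w = w.
Proof.
move=> Rsimple winf rw0.
have Lrw : [set x | exists a, x = a * (r * w)] (r * w) by exists 1; rewrite mul1r.
have [n [u [v [Lu uv1]]]] := ideal_simple_unit Rsimple (left_ideal_principal _) Lrw rw0.
have trans x y z : x + y = y -> y + z = z -> x + z = z.
  by move=> xy <-; rewrite addrA xy.
have one_le : 1 + w * r * w = w * r * w.
  rewrite uv1; elim/big_ind: _ => [|x y xw yw|k _].
  - by rewrite add0r.
  - by rewrite -addrA yw xw.
  (* Termwise chain [a r w (v k) <= a r w w <= a r w <= w r w], each link coming from [x <= w] for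
     all [x]. *)
  have [a ->] := Lu k.
  have step : a * r * w + w * r * w = w * r * w by rewrite -2!mulrDl winf.
  have aww : a * r * w * w + a * r * w = a * r * w.
    by rewrite -mulrA -mulrDr winf.
  have awv : a * r * w * v k + a * r * w * w = a * r * w * w.
    by rewrite -mulrDr winf.
  by rewrite mulrA; exact: trans awv (trans _ _ _ aww step).
have ww : w * w + w = w := winf _.
rewrite -[RHS](winf (w * r * w)).
(* Multiplying [1 <= w r w] by [w] gives [w <= w w r w <= w r w]; the reverse bound is [winf]. *)
have wle : w + w * (w * r * w) = w * (w * r * w) by rewrite -{1}[w]mulr1 -mulrDr one_le.
have wwle : w * (w * r * w) + w * r * w = w * r * w.
  by rewrite !mulrA -2!mulrDl ww.
by rewrite addrC (trans _ _ _ wle wwle).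
Qed.

(** A nonzero [r * w] in a smaller left ideal [J] brings back [w = w * (r * w)], so [J] contains all
    multiples of [w]. *)
Lemma infinite_element_minimal w :
  proper_semiring R -> ideal_simple R -> infinite_element w ->
  minimal_left_ideal [set x | exists r, x = r * w].
Proof.
move=> Rproper Rsimple winf.
split=> [|L0|J [[J0 JD] JM] Jn0 JL].
- exact: left_ideal_principal.
- have w0 : w = 0.
    by have : [set x | exists r, x = r * w] w; [exists 1; rewrite mul1r|rewrite L0].
  by apply: Rproper => x; exists 0; rewrite -w0.
have [x Jx x0] := left_ideal_nonzero (conj (conj J0 JD) JM) Jn0.
rewrite eqEsubset; split=> // _ [s ->].
have [r xE] := JL _ Jx; apply: (JM); rewrite -(@infinite_element_absorb w r) //.
  by rewrite -mulrA -xE; exact: JM.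
by rewrite -xE.
Qed.

End IdealSimple.

(** * Passage to the converse semiring *)

Lemma ideal_simple_converse (R : pzSemiRingType) : ideal_simple R -> ideal_simple R^c.
Proof. by move=> Rsimple I [lI rI]; exact: Rsimple. Qed.

(** The notion is self-dual: reversing products exchanges [u] with [v] and [al] with [be]. *)
Lemma separated_unit_converse (R : pzSemiRingType) :
  separated_unit R^c -> separated_unit R.
Proof.
move=> [n [u [v [al [be [uv1 sep]]]]]].
exists n, v, u, be, al; split=> [|a b j k]; first exact: uv1.
by rewrite orbC -sep.
Qed.

(** * Ideal-simplicity of E_M *)

Section EndoSimple.
Context {d : Order.disp_t}.
Variable M : finTBDistrLatticeType d.
Implicit Types (x y p c : M) (f g : join_endo M).
Local Open Scope order_scope.
Local Notation bot := (\bot : M).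

Definition join_prime p := p != bot /\ forall x y, p <= x `|` y -> p <= x \/ p <= y.

Lemma join_prime_separates b c : ~~ (b <= c) ->
  exists p, [/\ join_prime p, p <= b & ~~ (p <= c)].
Proof.
move=> nbc; pose S x := (x <= b) && ~~ (x <= c).
have Sb : S b by rewrite /S lexx.
(* Take [p] minimal in [S], ranked by the size of its down-set. If [p] were below [x] join [y] but
   below neither, both meets with [p] would be smaller, hence below [c], and so would [p] by
   distributivity. *)
have [p /andP[pb npc] pmin] := @arg_minnP M b S (fun x => #|[set y | y <= x]%SET|) Sb.
exists p; split=> //; split=> [|x y pxy].
  by apply: contra npc => /eqP ->; exact: le0x.
have small z : p `&` z != p -> p `&` z <= c.
  move=> pz; apply: contraNT pz => npzc.
  have /pmin : S (p `&` z) by rewrite /S npzc (le_trans (leIl _ _) pb).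
  rewrite leqNgt => /negP H; apply/eqP; apply: contrapT => /eqP pz; apply: H.
  apply: proper_card; apply/properP; split.
    by apply/fintype.subsetP => y0; rewrite !inE => /le_trans; apply; exact: leIl.
  exists p; rewrite !inE ?lexx //; apply: contra pz => ppz.
  by rewrite eq_le leIl.
apply: contrapT => /not_orP[npx npy].
move: npc; rewrite -(meet_idPl pxy) meetUr leUx !small //.
  by apply/eqP => /meet_idPl.
by apply/eqP => /meet_idPl.
Qed.

Section Threshold.
Variables (P : {pred M}) (b : M).
Hypothesis P0 : bot \notin P.
Hypothesis PU : forall x y, (x `|` y \in P) = (x \in P) || (y \in P).

Let threshold_fun x := if x \in P then b else bot.

Fact threshold_bot : threshold_fun bot = bot.
Proof. by rewrite /threshold_fun (negPf P0). Qed.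
Fact threshold_join x y :
  threshold_fun (x `|` y) = threshold_fun x `|` threshold_fun y.
Proof.
by rewrite /threshold_fun PU; case: (x \in P); case: (y \in P); rewrite ?joinxx ?joinx0 ?join0x.
Qed.

(** [P0] and [PU] say that the complement of [P] is a lattice ideal. *)
Definition threshold := JoinEndo threshold_bot threshold_join.

End Threshold.

Lemma join_endo_ideal_simple : ideal_simple (join_endo M).
Proof.
move=> I [[[I0 ID] IMl] [_ IMr]].
have [|In0] := pselect (I = [set 0]%classic); [by left|right].
have [g Ig [c gc]] : exists2 g, I g & exists c, g c <> bot.
  apply: contrapT => noI; apply: In0.
  rewrite eqEsubset; split=> g /=; last by move=> ->.
  move=> Ig; apply: join_endoP => c; apply: contrapT => gc.
  by apply: noI; exists g => //; exists c.
suff I1 : I 1 by rewrite eqEsubset; split=> // f _; rewrite -[f]mulr1; exact: IMl.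
have nz0 : bot \notin predC1 bot by rewrite inE eqxx.
have nzU x y : (x `|` y \in predC1 bot) = (x \in predC1 bot) || (y \in predC1 bot).
  by rewrite !inE join_eq0 negb_and.
have rank1 p : join_prime p -> exists f, I f /\ forall x, f x = if p <= x then p else bot.
  case=> pn0 pU.
  have up0 : bot \notin [pred x | p <= x] by rewrite inE lex0.
  have upU x y : (x `|` y \in [pred x | p <= x]) =
      (x \in [pred x | p <= x]) || (y \in [pred x | p <= x]).
    by rewrite !inE; apply/idP/orP => [/pU//|[]/le_trans]; apply; rewrite ?leUl ?leUr.
  (* The right factor sends everything above [p] to [c], [g] keeps it nonzero, and the left factor
     sends every nonzero value to [p]. *)
  exists (threshold p nz0 nzU * g * threshold c up0 upU)%R; split.
    by apply: IMr; apply: IMl.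
  move=> x /=; rewrite !inE; case: (p <= x); last by rewrite endo_bot eqxx.
  by have /eqP -> := gc.
(* The default 0 off the join-primes lets the sum range over all of [M]. *)
pose F p : join_endo M :=
  if pselect (join_prime p) is left pp then sval (cid (rank1 p pp)) else 0%R.
have IF p : I (F p).
  by rewrite /F; case: pselect => // pp; case: (cid _) => f [].
have FE p x : join_prime p -> F p x = if p <= x then p else bot.
  by rewrite /F; case: pselect => // pp _; case: (cid _) => f [].
have Fle p x : F p x <= x.
  rewrite /F; case: pselect => [pp|_]; last exact: le0x.
  by case: (cid _) => f [_ /= ->]; case: ifP => // _; exact: le0x.
suff -> : 1%R = (\sum_p F p)%R by elim/big_ind: _ => //; exact: IF.
apply: join_endoP => x; apply/eqP; rewrite eq_le; apply/andP; split.
  apply: contraT => /join_prime_separates[p [pp px /negP[]]].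
  rewrite (bigD1 p) //=; apply: le_trans (leUl _ _).
  by rewrite FE // (px : p <= x).
elim/big_ind: _ => [|f h fx hx|p _]; [exact: le0x|by rewrite /= leUx; apply/andP|exact: Fle].
Qed.

End EndoSimple.

(** * Ideal-simplicity pulled back along strong semiisomorphisms *)

Lemma ideal_semiiso_image (R S : pzSemiRingType) (f : {rmorphism R -> S}) (I : set R) :
  (forall y, exists x, f x = y) -> ideal I -> ideal (f @` I)%classic.
Proof.
move=> fsurj [[[I0 ID] IMl] [_ IMr]].
have sub : additive_submonoid (f @` I)%classic.
  split; first by exists 0; rewrite ?raddf0.
  by move=> _ _ [x Ix <-] [y Iy <-]; exists (x + y); rewrite ?raddfD //; exact: ID.
split; split=> // r _ [x Ix <-]; have [s <-] := fsurj r.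
  by exists (s * x); rewrite ?rmorphM //; exact: IMl.
by exists (x * s); rewrite ?rmorphM //; exact: IMr.
Qed.

(** A proper ideal has a proper image, which is zero by simplicity of [S], so it lies in the trivial
    kernel. *)
Lemma strong_semiiso_ideal_simple (R S : pzSemiRingType) :
  strongly_semiisomorphic R S -> ideal_simple S -> ideal_simple R.
Proof.
move=> [f [[fsurj fker] fstrong]] Ssimple I idI.
have [|InT] := pselect (I = setT); [by right|left].
case: (Ssimple _ (ideal_semiiso_image fsurj idI)) => [im0|/fstrong]; last by case.
rewrite eqEsubset; split=> x /=; last by move=> ->; case: idI => -[[]].
move=> Ix; have : (f @` I)%classic (f x) by exists x.
rewrite im0 => fx0; suff : [set x | f x = 0]%classic x by rewrite fker.
exact: fx0.
Qed.

(* finTBDistrLatticeType: nonempty finite distributive lattices, with their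
   least and greatest elements. *)
Theorem theorem5p12 (R : pzSemiRingType) (R_proper : proper_semiring R)
    (R_inf_or_proj : has_infinite_element R \/
       (has_projective_minimal_left_ideal R \/
        has_projective_minimal_right_ideal R)) :
  ideal_simple R <->
  exists (d : Order.disp_t) (M : finTBDistrLatticeType d),
    (exists x : M, x <> Order.bottom :> M) /\ strongly_semiisomorphic R (join_endo M).
Proof.
split=> [Rsimple|[d [M [_ /strong_semiiso_ideal_simple]]]]; last first.
  by apply; exact: join_endo_ideal_simple.
apply: strong_semiiso_of_separated_unit => //.
- exact: proper_semiring_nontrivial.
- by move=> x y; exact: ideal_simple_zerosumfree.
case: R_inf_or_proj => [[w winf]|[[L [_ [Lmin _]]]|[L [_ [Lmin _]]]]].
- by apply: minimal_left_ideal_separated_unit (infinite_element_minimal _ _ winf).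
- exact: minimal_left_ideal_separated_unit Lmin.
apply: separated_unit_converse.
exact: (@minimal_left_ideal_separated_unit R^c L) (ideal_simple_converse Rsimple) Lmin.
Qed.
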